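(* Let $\rho:\mathbb{R}_+\to\mathbb{R}_+$ and let $\epsilon\in(0,1]$. The Kruskal-based Algorithm described below, when run with $k=\rho(\epsilon)$, is a local sparse spanning graph algorithm for the family of $\rho$-hyperfinite graphs with degree bounded by $d$. Its query complexity and running time are $O(d^{\rho(\epsilon)+1})$, and its success probability is $1$. Kruskal-based Algorithm (parameter $k$, fixed for all queries): on query an edge $(x,y)$, perform a BFS to depth $k$ from $x$, obtaining the subgraph $C_k(x)$ of $G$ induced by $\Gamma_k(x)$. If $(x,y)$ is the edge of largest rank on some cycle in $C_k(x)$, answer NO; otherwise answer YES.
   Context: Graphs $G=(V,E)$ have $n=|V|$ vertices, degree bound $d$, and vertices have distinct ids from a totally ordered set; access is via incidence-list queries (the $i$-th neighbor of $v$). A local sparse spanning graph algorithm with respect to a class $\mathcal{C}$, given $n,\epsilon\ge0,0\le\delta<1$ and query access to a connected graph $G=(V,E)\in\mathcal{C}$, answers for each queried edge $(u,v)\in E$ whether $(u,v)\in E'$, where $E'$ is determined by $G$ and the internal randomness of the algorithm, such that $G'=(V,E')$ is connected with probability $1$ and $|E'|\le(1+\epsilon)n$ with probability at least $1-\delta$ (success probability $1$ means this bound holds always). $\Gamma_k(v)$ is the set of vertices at distance at most $k$ from $v$. The rank $r$ on edges: $r(u,v)<r(u',v')$ iff $\min\{id(u),id(v)\}<\min\{id(u'),id(v')\}$, or these minima are equal and $\max\{id(u),id(v)\}<\max\{id(u'),id(v')\}$. A graph $G=(V,E)$ is $(\epsilon,k)$-hyperfinite if one can remove at most $\epsilon|V|$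 edges so that every connected component of the remaining graph has at most $k$ vertices; $G$ is $\rho$-hyperfinite if it is $(\epsilon,\rho(\epsilon))$-hyperfinite for every $\epsilon\in(0,1]$. *)

(* Defs.v *)
From HB Require Import structures.
From mathcomp Require Import all_boot all_order all_algebra.
From mathcomp Require Import all_classical all_reals all_analysis.

Set Implicit Arguments.
Unset Strict Implicit.
Unset Printing Implicit Defensive.

Import Order.TTheory GRing.Theory Num.Theory.

(* A simple undirected graph on n vertices.  The elements of 'I_n are only the
   names under which vertices are queried; the ids, which determine the ranks of
   edges, are distinct elements of an arbitrary totally ordered set O. *)
Record graph (disp : Order.disp_t) (O : orderType disp) (n : nat) := Graph {
  nbrs : 'I_n -> seq 'I_n;
  vid : 'I_n -> O;
  nbrs_uniq : forall v, uniq (nbrs v);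
  nbrs_irrefl : forall v, v \notin nbrs v;
  nbrs_sym : forall u v, (u \in nbrs v) = (v \in nbrs u);
  vid_inj : injective vid
}.

Definition degree_bounded (disp : Order.disp_t) (O : orderType disp) (n : nat)
    (d : nat) (G : graph O n) : Prop :=
  forall v, size (nbrs G v) <= d.

(* Undirected edges are two-element sets of vertices. *)
Definition edges (disp : Order.disp_t) (O : orderType disp) (n : nat)
    (G : graph O n) : {set {set 'I_n}} :=
  [set e | [exists u, exists v, (e == [set u; v]) && (v \in nbrs G u)]].

Definition adj (n : nat) (F : {set {set 'I_n}}) : rel 'I_n :=
  fun u v => [set u; v] \in F.

Definition component (n : nat) (F : {set {set 'I_n}}) (v : 'I_n) : {set 'I_n} :=
  [set u | connect (adj F) v u].

Definition connected_graph (n : nat) (F : {set {set 'I_n}}) : Prop :=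
  forall u v, connect (adj F) u v.

Local Open Scope ring_scope.

Definition hyperfinite (R : realType) (disp : Order.disp_t) (O : orderType disp)
    (n : nat) (eps k : R) (G : graph O n) : Prop :=
  exists F : {set {set 'I_n}},
    [/\ F \subset edges G,
        #|F|%:R <= eps * n%:R &
        forall v, #|component (edges G :\: F) v|%:R <= k].

Definition rho_hyperfinite (R : realType) (disp : Order.disp_t)
    (O : orderType disp) (n : nat) (rho : R -> R) (G : graph O n) : Prop :=
  forall eps : R, 0 < eps <= 1 -> hyperfinite eps (rho eps) G.

Definition ball_le (R : realType) (disp : Order.disp_t) (O : orderType disp)
    (n : nat) (G : graph O n) (k : R) (v : 'I_n) : {set 'I_n} :=
  [set u | `[< exists p : seq 'I_n,
     [/\ path (adj (edges G)) v p, last v p = u & (size p)%:R <= k] >] ].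

Definition ball_edges (R : realType) (disp : Order.disp_t) (O : orderType disp)
    (n : nat) (G : graph O n) (k : R) (v : 'I_n) : {set {set 'I_n}} :=
  [set e in edges G | e \subset ball_le G k v].

Definition rank_lt (disp : Order.disp_t) (O : orderType disp) (n : nat)
    (G : graph O n) (u v u' v' : 'I_n) : bool :=
  let lo a b := Order.min (vid G a) (vid G b) in
  let hi a b := Order.max (vid G a) (vid G b) in
  ((lo u v < lo u' v')%O) ||
  ((lo u v == lo u' v') && (hi u v < hi u' v')%O).

Definition graph_cycle (n : nat) (F : {set {set 'I_n}}) (c : seq 'I_n) : Prop :=
  [/\ (2 < size c)%N, uniq c & cycle (adj F) c].

Definition cycle_edges (n : nat) (c : seq 'I_n) : {set {set 'I_n}} :=
  [set [set u; next c u] | u in c].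

Definition largest_on_cycle (disp : Order.disp_t) (O : orderType disp) (n : nat)
    (G : graph O n) (F : {set {set 'I_n}}) (x y : 'I_n) : Prop :=
  exists c : seq 'I_n,
    [/\ graph_cycle F c, [set x; y] \in cycle_edges c &
        forall u v, [set u; v] \in cycle_edges c -> [set u; v] != [set x; y] ->
          rank_lt G u v x y].

Local Close Scope ring_scope.

(* Memory consists of arrays of natural numbers, indexed by natural numbers;
   a scalar variable is cell 0 of an array.  Every operation has unit cost. *)
Inductive expr :=
| Cst of nat
| Get of nat & expr
| Plus of expr & expr
| Minus of expr & expr.

(* [IdLt a b] compares the ids of the vertices named by a and b. *)
Inductive test :=
| Lt of expr & expr
| Eq of expr & expr
| IdLt of expr & expr
| And of test & test
| Or of test & test.

(* [Query a v i] asks for the i-th neighbor (counting from 0) of v.  Variable a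
   receives w.+1 if the answer is w, and 0 if v has at most i neighbors. *)
Inductive cmd :=
| Skip
| Set_ of nat & expr & expr
| Query of nat & expr & expr
| Seq of cmd & cmd
| If of test & cmd & cmd
| While of test & cmd.

Record oracle := Oracle {
  neighbor : nat -> nat -> nat;
  id_lt : nat -> nat -> bool
}.

Definition memory := nat -> nat -> nat.

Record state := State { cells : memory; queries : nat; steps : nat }.

Definition update (m : memory) (a i x : nat) : memory :=
  fun b j => if (b == a) && (j == i) then x else m b j.

Fixpoint eval (m : memory) (e : expr) : nat :=
  match e with
  | Cst c => c
  | Get a i => m a (eval m i)
  | Plus e1 e2 => eval m e1 + eval m e2
  | Minus e1 e2 => eval m e1 - eval m e2
  end.

Fixpoint expr_cost (e : expr) : nat :=
  match e with
  | Cst _ => 1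
  | Get _ i => (expr_cost i).+1
  | Plus e1 e2 | Minus e1 e2 => (expr_cost e1 + expr_cost e2).+1
  end.

Fixpoint holds (orc : oracle) (m : memory) (t : test) : bool :=
  match t with
  | Lt e1 e2 => eval m e1 < eval m e2
  | Eq e1 e2 => eval m e1 == eval m e2
  | IdLt e1 e2 => id_lt orc (eval m e1) (eval m e2)
  | And t1 t2 => holds orc m t1 && holds orc m t2
  | Or t1 t2 => holds orc m t1 || holds orc m t2
  end.

Fixpoint test_cost (t : test) : nat :=
  match t with
  | Lt e1 e2 | Eq e1 e2 | IdLt e1 e2 => (expr_cost e1 + expr_cost e2).+1
  | And t1 t2 | Or t1 t2 => (test_cost t1 + test_cost t2).+1
  end.

Definition tick (c : nat) (s : state) : state :=
  State (cells s) (queries s) (steps s + c).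

(* [None] means that the computation has not halted within the given fuel. *)
Fixpoint exec (orc : oracle) (fuel : nat) (c : cmd) (s : state) : option state :=
  if fuel is f.+1 then
    match c with
    | Skip => Some s
    | Set_ a i e =>
        Some (State (update (cells s) a (eval (cells s) i) (eval (cells s) e))
                    (queries s) (steps s + (expr_cost i + expr_cost e).+1))
    | Query a v i =>
        Some (State (update (cells s) a 0
                       (neighbor orc (eval (cells s) v) (eval (cells s) i)))
                    (queries s).+1 (steps s + (expr_cost v + expr_cost i).+1))
    | Seq c1 c2 => obind (exec orc f c2) (exec orc f c1 s)
    | If t c1 c2 =>
        exec orc f (if holds orc (cells s) t then c1 else c2)
             (tick (test_cost t).+1 s)
    | While t c1 =>
        if holds orc (cells s) t
        then obind (exec orc f c) (exec orc f c1 (tick (test_cost t).+1 s))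
        else Some (tick (test_cost t).+1 s)
    end
  else None.

Definition graph_oracle (disp : Order.disp_t) (O : orderType disp) (n : nat)
    (G : graph O n) : oracle :=
  Oracle
    (fun v i =>
       if insub v is Some v' then
         if onth (nbrs G v') i is Some w then (val w).+1 else 0
       else 0)
    (fun u v =>
       if (insub u, insub v) is (Some u', Some v')
       then (vid G u' < vid G v')%O else false).

(* Array 0 holds the input, array 1 the random words, and cell 0 of array 2
   the answer. *)
Definition INPUT := 0.
Definition RANDOM := 1.
Definition ANSWER := 2.

(* The input is n, the endpoints x and y of the queried edge, and parameters
   that are the same for all queries; all other memory is initially 0. *)
Definition initial_memory (n : nat) (params : seq nat) (tape : nat -> nat)
    (x y : nat) : memory :=
  fun a i => if a == INPUT then nth 0 [:: n, x, y & params] i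
             else if a == RANDOM then tape i else 0.

(* On query (x, y) program p halts with answer b (true is YES), having made q
   queries to the graph and t steps. *)
Definition runs (disp : Order.disp_t) (O : orderType disp) (n : nat) (p : cmd)
    (params : seq nat) (tape : nat -> nat) (G : graph O n) (x y : 'I_n)
    (b : bool) (q t : nat) : Prop :=
  exists (fuel : nat) (s : state),
    [/\ exec (graph_oracle G) fuel p
          (State (initial_memory n params tape x y) 0 0) = Some s,
        b = (0 < cells s ANSWER 0), q = queries s & t = steps s].

Definition answers (disp : Order.disp_t) (O : orderType disp) (n : nat) (p : cmd)
    (params : seq nat) (tape : nat -> nat) (G : graph O n) (x y : 'I_n)
    (b : bool) : Prop :=
  exists q t, runs p params tape G x y b q t.

(* An algorithm receives an edge as an ordered pair of endpoints.  An
   orientation fixes, for each edge, the order in which it is passed, so that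
   each edge gets exactly one answer. *)
Definition orientation (disp : Order.disp_t) (O : orderType disp) (n : nat)
    (G : graph O n) (o : rel 'I_n) : Prop :=
  forall u v, v \in nbrs G u -> o u v = ~~ o v u.

(* The edge set E' determined by G and the random words. *)
Definition kept_edges (disp : Order.disp_t) (O : orderType disp) (n : nat)
    (p : cmd) (params : seq nat) (tape : nat -> nat) (G : graph O n)
    (o : rel 'I_n) : {set {set 'I_n}} :=
  [set e | `[< exists x y, [/\ e = [set x; y], y \in nbrs G x, o x y &
                               answers p params tape G x y true] >] ].

Local Open Scope ring_scope.

Definition sparse (R : realType) (n : nat) (eps : R) (F : {set {set 'I_n}}) : Prop :=
  #|F|%:R <= (1 + eps) * n%:R.

(* The internal randomness is a sequence of random words [tape w], with w drawn
   from the probability space (Omega, P). *)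
Definition local_sparse_spanning (R : realType) (disp : Order.disp_t)
    (O : orderType disp) (C : forall n, graph O n -> Prop) (eps delta : R)
    (p : cmd) (params : seq nat) (dO : measure_display)
    (Omega : measurableType dO) (P : probability Omega R)
    (tape : Omega -> nat -> nat) : Prop :=
  forall (n : nat) (G : graph O n) (o : rel 'I_n),
    connected_graph (edges G) -> C n G -> orientation G o ->
    let E' w := kept_edges p params (tape w) G o in
    let conn := [set w | connected_graph (E' w)]%classic in
    let small := [set w | sparse eps (E' w)]%classic in
    [/\ forall w x y, y \in nbrs G x ->
          exists b, answers p params (tape w) G x y b,
        measurable conn /\ P conn = 1%:E &
        measurable small /\ ((1 - delta)%:E <= P small)%E].

Definition always_sparse (R : realType) (disp : Order.disp_t)
    (O : orderType disp) (C : forall n, graph O n -> Prop) (eps : R)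
    (p : cmd) (params : seq nat) : Prop :=
  forall (n : nat) (G : graph O n) (o : rel 'I_n) (tape : nat -> nat),
    connected_graph (edges G) -> C n G -> orientation G o ->
    sparse eps (kept_edges p params tape G o).

Definition queries_and_time_le (R : realType) (disp : Order.disp_t)
    (O : orderType disp) (C : forall n, graph O n -> Prop)
    (p : cmd) (params : seq nat) (B : R) : Prop :=
  forall (n : nat) (G : graph O n) (tape : nat -> nat) (x y : 'I_n),
    connected_graph (edges G) -> C n G -> y \in nbrs G x ->
    exists b q t, [/\ runs p params tape G x y b q t, q%:R <= B & t%:R <= B].

Definition hyperfinite_family (R : realType) (disp : Order.disp_t)
    (O : orderType disp) (rho : R -> R) (d : nat) (n : nat) (G : graph O n) : Prop :=
  rho_hyperfinite rho G /\ degree_bounded d G.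

Local Close Scope ring_scope.

Definition input_x := Get INPUT (Cst 1).
Definition input_y := Get INPUT (Cst 2).
Definition input_k := Get INPUT (Cst 3).

(* DEPTH[v] is 1 + the distance from x to v if v has been discovered, else 0.
   The neighbors of v are ADJ[FIRST[v]], ..., ADJ[LAST[v] - 1]. *)
Definition QUEUE := 3.
Definition DEPTH := 4.
Definition ADJ := 5.
Definition FIRST := 6.
Definition LAST := 7.
Definition QUEUE2 := 8.
Definition MARK := 9.
Definition head_ := 10.
Definition tail_ := 11.
Definition ptr_ := 12.
Definition v_ := 13.
Definition i_ := 14.
Definition w_ := 15.
Definition u_ := 16.
Definition lo_ := 17.
Definition hi_ := 18.
Definition a_ := 19.
Definition b_ := 20.

Definition var (a : nat) : expr := Get a (Cst 0).
Definition assign (a : nat) (e : expr) : cmd := Set_ a (Cst 0) e.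
Definition incr (a : nat) : cmd := assign a (Plus (var a) (Cst 1)).
Definition block (cs : seq cmd) : cmd := foldr Seq Skip cs.

(* Also the vertices at depth k are queried, in order to obtain the induced
   subgraph; their undiscovered neighbors stay undiscovered. *)
Definition bfs : cmd := block
  [:: Set_ QUEUE (Cst 0) input_x;
      Set_ DEPTH input_x (Cst 1);
      assign head_ (Cst 0);
      assign tail_ (Cst 1);
      assign ptr_ (Cst 0);
      While (Lt (var head_) (var tail_)) (block
        [:: assign v_ (Get QUEUE (var head_));
            Set_ FIRST (var v_) (var ptr_);
            assign i_ (Cst 0);
            Query w_ (var v_) (var i_);
            While (Lt (Cst 0) (var w_)) (block
              [:: assign u_ (Minus (var w_) (Cst 1));
                  Set_ ADJ (var ptr_) (var u_);
                  incr ptr_;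
                  If (And (Eq (Get DEPTH (var u_)) (Cst 0))
                          (Lt (Get DEPTH (var v_)) (Plus input_k (Cst 1))))
                    (block
                      [:: Set_ DEPTH (var u_) (Plus (Get DEPTH (var v_)) (Cst 1));
                          Set_ QUEUE (var tail_) (var u_);
                          incr tail_])
                    Skip;
                  incr i_;
                  Query w_ (var v_) (var i_)]);
            Set_ LAST (var v_) (var ptr_);
            incr head_])].

Definition sort_ids (lo hi : nat) (e1 e2 : expr) : cmd :=
  If (IdLt e2 e1)
    (Seq (assign lo e2) (assign hi e1))
    (Seq (assign lo e1) (assign hi e2)).

(* Marks the vertices that are reachable from x in the subgraph found by [bfs]
   along edges of rank smaller than that of (x, y): y is marked iff (x, y) is
   the edge of largest rank on some cycle of this subgraph. *)
Definition cycle_search : cmd := block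
  [:: sort_ids lo_ hi_ input_x input_y;
      Set_ QUEUE2 (Cst 0) input_x;
      Set_ MARK input_x (Cst 1);
      assign head_ (Cst 0);
      assign tail_ (Cst 1);
      While (Lt (var head_) (var tail_)) (block
        [:: assign v_ (Get QUEUE2 (var head_));
            assign i_ (Get FIRST (var v_));
            While (Lt (var i_) (Get LAST (var v_))) (block
              [:: assign u_ (Get ADJ (var i_));
                  sort_ids a_ b_ (var v_) (var u_);
                  If (And (And (Lt (Cst 0) (Get DEPTH (var u_)))
                               (Eq (Get MARK (var u_)) (Cst 0)))
                          (Or (IdLt (var a_) (var lo_))
                              (And (Eq (var a_) (var lo_))
                                   (IdLt (var b_) (var hi_)))))
                    (block
                      [:: Set_ MARK (var u_) (Cst 1);
                          Set_ QUEUE2 (var tail_) (var u_);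
                          incr tail_])
                    Skip;
                  incr i_]);
            incr head_])].

Definition kruskal : cmd := block
  [:: bfs;
      cycle_search;
      If (Eq (Get MARK input_y) (Cst 0))
        (assign ANSWER (Cst 1))
        (assign ANSWER (Cst 0))].

(* Main.v *)
Require Import Defs.
From mathcomp Require Import all_boot all_order all_algebra.
From mathcomp Require Import all_classical all_reals all_analysis.
From mathcomp Require Import zify.
Import Order.TTheory GRing.Theory Num.Theory.

Set Implicit Arguments.
Unset Strict Implicit.
Unset Printing Implicit Defensive.

(** An edge (x, y) is the edge of largest rank on a cycle of a graph containing
    it iff x and y are joined by edges of smaller rank.  So the second search of
    the program decides the question for C_k(x).  A rejected edge of minimal
    rank among those whose ends E' fails to connect would be bypassed by smaller
    edges, so E' is connected.  Let F be the edges removed by hyperfiniteness: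
    every path in E' \ F stays in a component with at most k vertices, so the
    edge of largest rank on a cycle of E' \ F would have seen that cycle and
    been rejected.  Hence E' \ F is a forest and |E'| <= n + eps n.  The two
    searches cost O(d |Gamma_k(x)|), and Gamma_k(x) has at most 2 d^k elements:
    for d >= 2 by a geometric sum, for d = 1 because it is {x, y}. *)

(** * Total correctness of programs *)

Lemma exec_mono (orc : oracle) (f g : nat) (c : cmd) (s s' : state) :
  f <= g -> exec orc f c s = Some s' -> exec orc g c s = Some s'.
Proof.
elim: f g c s s' => [|f IH] [|g] c s s' //= le_fg.
case: c => [|a i e|a v i|c1 c2|t c1 c2|t c1] //=.
- case E: (exec orc f c1 s) => [s1|] //= H.
  by rewrite (IH _ _ _ _ le_fg E) /=; apply: IH H.
- exact: IH.
- case: ifP => // _.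
  case E: (exec orc f c1 _) => [s1|] //= H.
  by rewrite (IH _ _ _ _ le_fg E) /=; apply: IH H.
Qed.

Lemma exec_inj (orc : oracle) (f g : nat) (c : cmd) (s s1 s2 : state) :
  exec orc f c s = Some s1 -> exec orc g c s = Some s2 -> s1 = s2.
Proof.
move=> H1 H2; have := exec_mono (leq_maxl f g) H1.
by rewrite (exec_mono (leq_maxr f g) H2) => -[].
Qed.

(** Total correctness as a weakest precondition: the fuel is existential, and by [exec_mono] the
    fuels of successive commands can be raised to a common value. *)
Definition halts_in (orc : oracle) (c : cmd) (s : state) (Q : state -> Prop) :=
  exists f s', exec orc f c s = Some s' /\ Q s'.

Lemma halts_in_weaken (orc : oracle) (c : cmd) (s : state)
    (P Q : state -> Prop) :
  halts_in orc c s P -> (forall s', P s' -> Q s') -> halts_in orc c s Q.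
Proof. by move=> [f [s' [E Ps]]] PQ; exists f, s'; split=> //; apply: PQ. Qed.

Lemma halts_in_skip (orc : oracle) (s : state) (Q : state -> Prop) :
  Q s -> halts_in orc Skip s Q.
Proof. by exists 1, s. Qed.

(* The evaluated index and value are separate variables so that they can be
   instantiated with simplified expressions. *)
Lemma halts_in_set (orc : oracle) (a : nat) (i e : expr) (j x : nat)
    (m : memory) (q t : nat) (Q : state -> Prop) :
  Defs.eval m i = j -> Defs.eval m e = x ->
  Q (State (update m a j x) q (t + (expr_cost i + expr_cost e).+1)) ->
  halts_in orc (Set_ a i e) (State m q t) Q.
Proof. by move=> <- <- H; exists 1; eexists; split; [reflexivity|]. Qed.

Lemma halts_in_query (orc : oracle) (a : nat) (v i : expr) (u j : nat)
    (m : memory) (q t : nat) (Q : state -> Prop) :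
  Defs.eval m v = u -> Defs.eval m i = j ->
  Q (State (update m a 0 (neighbor orc u j)) q.+1
       (t + (expr_cost v + expr_cost i).+1)) ->
  halts_in orc (Query a v i) (State m q t) Q.
Proof. by move=> <- <- H; exists 1; eexists; split; [reflexivity|]. Qed.

Lemma halts_in_seq (orc : oracle) (c1 c2 : cmd) (s : state)
    (Q : state -> Prop) :
  halts_in orc c1 s (fun s' => halts_in orc c2 s' Q) ->
  halts_in orc (Seq c1 c2) s Q.
Proof.
move=> [f1 [s1 [E1 [f2 [s2 [E2 Qs]]]]]].
exists (maxn f1 f2).+1, s2; split=> //=.
by rewrite (exec_mono (leq_maxl _ _) E1) /= (exec_mono (leq_maxr _ _) E2).
Qed.

Lemma halts_in_if (orc : oracle) (t : test) (c1 c2 : cmd) (s : state)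
    (Q : state -> Prop) :
  halts_in orc (if holds orc (cells s) t then c1 else c2)
    (tick (test_cost t).+1 s) Q ->
  halts_in orc (If t c1 c2) s Q.
Proof. by move=> [f [s' [E Qs]]]; exists f.+1, s'. Qed.

(** The index [i] is a ghost iteration count on which the invariant may depend, in particular for
    costs. It stays below [N] while the guard holds, so [N - i] is the variant. *)
Lemma halts_in_while (orc : oracle) (t : test) (c : cmd)
    (I : nat -> state -> Prop) (i0 N : nat) (s : state) (Q : state -> Prop) :
  (forall i s, I i s -> holds orc (cells s) t -> i < N) ->
  (forall i s, I i s -> holds orc (cells s) t ->
     halts_in orc c (tick (test_cost t).+1 s) (I i.+1)) ->
  (forall i s, I i s -> ~~ holds orc (cells s) t ->
     Q (tick (test_cost t).+1 s)) ->
  I i0 s -> halts_in orc (While t c) s Q.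
Proof.
move=> ltN step final; move: {2}(N - i0) (leqnn (N - i0)) => k.
elim: k i0 s => [|k IH] i s le_k Is.
  have Ht : ~~ holds orc (cells s) t.
    by apply/negP => Ht; have := ltN _ _ Is Ht; lia.
  exists 1; eexists; split; first by rewrite /= (negbTE Ht).
  exact: final Is Ht.
have [Ht|Ht] := boolP (holds orc (cells s) t); last first.
  exists 1; eexists; split; first by rewrite /= (negbTE Ht).
  exact: final Is Ht.
have [f1 [s1 [E1 Is1]]] := step _ _ Is Ht.
have [|f2 [s2 [E2 Qs]]] := IH _ _ _ Is1.
  by have := ltN _ _ Is Ht; lia.
exists (maxn f1 f2).+1, s2; split=> //.
rewrite /= Ht (exec_mono (leq_maxl _ _) E1) /=.
exact: exec_mono (leq_maxr _ _) E2.
Qed.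

Lemma answers_inj (disp : Order.disp_t) (O : orderType disp) (n : nat) (p : cmd)
    (params : seq nat) (tape : nat -> nat) (G : graph O n) (x y : 'I_n)
    (b b' : bool) :
  answers p params tape G x y b -> answers p params tape G x y b' -> b = b'.
Proof.
move=> [q [t [f [s [E -> _ _]]]]] [q' [t' [f' [s' [E' -> _ _]]]]].
by rewrite (exec_inj E E').
Qed.

(** * Cycles, forests and balls *)

Lemma set2_eq (T : finType) (u v x y : T) :
  [set u; v] = [set x; y] -> (u = x /\ v = y) \/ (u = y /\ v = x).
Proof.
move=> E.
have := set21 u v; rewrite E => /set2P Hu.
have := set22 u v; rewrite E => /set2P Hv.
have := set21 x y; rewrite -E => /set2P Hx.
have := set22 x y; rewrite -E => /set2P Hy.
by case: Hu Hv Hx Hy => -> [] -> [] ? [] ?; subst; auto.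
Qed.

Arguments adj : simpl never.
Arguments rank_lt : simpl never.

Lemma adj_sym (n : nat) (F : {set {set 'I_n}}) : symmetric (adj F).
Proof. by move=> u v; rewrite /adj finset.setUC. Qed.

(** Each component of [F'] is a union of components of [F], so inclusion defines a surjection from
    the latter onto the former. It identifies the components of [x] and [y], hence stays surjective
    when that of [x] is dropped. *)
Lemma component_add_edge (n : nat) (F F' : {set {set 'I_n}}) (x y : 'I_n) :
  F \subset F' -> [set x; y] \in F' -> ~~ connect (adj F) x y ->
  #|[set component F' v | v : 'I_n]| < #|[set component F v | v : 'I_n]|.
Proof.
move=> sFF' xyF' Nxy.
have sc u v : connect (adj F) u v -> connect (adj F') u v.
  apply: connect_sub => a b /= ab; apply: connect1.
  exact: (fintype.subsetP sFF').
have symF := adj_sym F; have symF' := adj_sym F'.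
have csym' : connect_sym (adj F') by exact: sym_connect_sym.
pose f (C : {set 'I_n}) := \bigcup_(v in C) component F' v.
have fE v : f (component F v) = component F' v.
  apply/setP => u; apply/bigcupP/idP => [[w]|uv].
    rewrite !inE => /sc vw wu; exact: connect_trans vw wu.
  by exists v => //; rewrite inE.
have cxy : component F' x = component F' y.
  apply/setP => u; rewrite !inE.
  apply: same_connect => //; exact: connect1.
rewrite [X in _ < X](cardsD1 (component F x)) finset.imset_f //= add1n ltnS.
apply: leq_trans (leq_imset_card f _); apply: subset_leq_card.
apply/fintype.subsetP => _ /imsetP[v _ ->].
have [vx|vx] := eqVneq (component F v) (component F x).
  apply/imsetP; exists (component F y); last first.
    by rewrite fE -cxy -!fE vx.
  rewrite !inE finset.imset_f // andbT; apply: contra Nxy => /eqP /setP /(_ y).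
  by rewrite !inE connect0 => <-.
apply/imsetP; exists (component F v); last by rewrite fE.
by rewrite !inE vx finset.imset_f.
Qed.

(* Each edge of a forest, added in turn, merges two components. *)
Lemma card_forest (n : nat) (F : {set {set 'I_n}}) :
  (forall F' : {set {set 'I_n}}, F' \subset F -> F' != finset.set0 ->
     exists x y, [set x; y] \in F' /\
       ~~ connect (adj (F' :\ [set x; y])) x y) ->
  #|F| <= n.
Proof.
move=> H.
(* Counting components makes the bound inductive: deleting an edge lowers the first summand by one
   and raises the second by at least one. *)
suff: #|F| + #|[set component F v | v : 'I_n]| <= n by lia.
move: {2}#|F| (erefl #|F|) => c; elim: c F H => [|c IH] F H Fc.
  by rewrite Fc (leq_trans (leq_imset_card _ _)) // card_ord.
have [|x [y [xyF Nxy]]] := H F (fintype.subxx _).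
  by rewrite -cards_eq0 Fc.
have := component_add_edge (finset.subsetDl F [set [set x; y]]) xyF Nxy.
have := Fc; rewrite (cardsD1 [set x; y] F) xyF add1n => -[cF].
have /IH/(_ cF) : forall F' : {set {set 'I_n}}, F' \subset F :\ [set x; y] ->
    F' != finset.set0 -> exists x y, [set x; y] \in F' /\
    ~~ connect (adj (F' :\ [set x; y])) x y.
  move=> F' sF'; apply: H; apply: fintype.subset_trans sF' _.
  exact: finset.subsetDl.
by rewrite cF addSn => le_n lt_c; apply: leq_trans le_n; rewrite ltn_add2l.
Qed.

(** * Ranks, and edges of largest rank on a cycle *)

Section Graph.
Variables (disp : Order.disp_t) (O : orderType disp) (n : nat) (G : graph O n).

Lemma adj_edges (u v : 'I_n) : adj (edges G) u v = (v \in nbrs G u).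
Proof.
rewrite /adj inE; apply/existsP/idP => [[a /existsP[b /andP[/eqP]]]|uv].
  by move=> /set2_eq[] [-> ->] //; rewrite nbrs_sym.
by exists u; apply/existsP; exists v; rewrite eqxx.
Qed.

(** The lexicographic product is a total order, so edges of least and of largest rank can be
    chosen. *)
Definition rank (u v : 'I_n) : O *l O :=
  (Order.min (vid G u) (vid G v), Order.max (vid G u) (vid G v)).

Lemma rank_ltE (u v x y : 'I_n) :
  rank_lt G u v x y = (rank u v < rank x y)%O.
Proof.
rewrite /rank_lt /rank ltEprodlexi /=.
by case: ltgtP.
Qed.

Lemma rankC (u v : 'I_n) : rank u v = rank v u.
Proof. by rewrite /rank minC maxC. Qed.

Lemma rank_set2 (u v x y : 'I_n) :
  [set u; v] = [set x; y] -> rank u v = rank x y.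
Proof. by move=> /set2_eq[] [-> ->] //; rewrite rankC. Qed.

Lemma rank_inj (u v x y : 'I_n) :
  rank u v = rank x y -> [set u; v] = [set x; y].
Proof.
rewrite /rank !minElt !maxElt.
case: ifP; case: ifP => _ _ [] /vid_inj -> /vid_inj -> //;
  by rewrite finset.setUC.
Qed.

Definition below (F : {set {set 'I_n}}) (x y : 'I_n) : rel 'I_n :=
  [rel u v | adj F u v && rank_lt G u v x y].

Lemma below_sym F x y : symmetric (below F x y).
Proof.
move=> u v; rewrite /below /= !rank_ltE (rankC u v); congr (_ && _).
exact: adj_sym.
Qed.

(** Removing the edge from the cycle leaves a path between its ends, all of whose edges have smaller
    rank. *)
Lemma largest_on_cycle_below (F : {set {set 'I_n}}) (x y : 'I_n) :
  largest_on_cycle G F x y -> connect (below F x y) x y.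
Proof.
have csym : connect_sym (below F x y) by exact/sym_connect_sym/below_sym.
(* Stated for an arbitrary pair of endpoints: [next c] may traverse the edge in
   either direction. *)
have key (a b : 'I_n) c : graph_cycle F c -> a \in c -> b = next c a ->
    [set a; b] = [set x; y] ->
    (forall u v, [set u; v] \in cycle_edges c -> [set u; v] != [set x; y] ->
          rank_lt G u v x y) -> connect (below F x y) a b.
  move=> [c2 Uc Cc] ac -> abxy lar; rewrite csym.
  have [i s Es] := rot_to ac.
  have nE z : next c z = next (a :: s) z by rewrite -Es next_rot.
  have memE z : (z \in c) = (z \in a :: s) by rewrite -Es mem_rot.
  have Us : uniq (a :: s) by rewrite -Es rot_uniq.
  have Cs : cycle (adj F) (a :: s) by rewrite -Es rot_cycle.
  have ss : 2 < size (a :: s) by rewrite -Es size_rot.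
  case: s => [//|b' s] in Es nE memE Us Cs ss *.
  rewrite nE /= eqxx.
  have {}abxy : [set a; b'] = [set x; y] by rewrite -abxy nE /= eqxx.
  apply/connectP; exists (rcons s a); last by rewrite last_rcons.
  move: Cs => /= /andP[_ Cs].
  apply/(pathP a) => j; rewrite size_rcons ltnS => js.
  have adjj : adj F (nth a (b' :: rcons s a) j) (nth a (rcons s a) j).
    by move/(pathP a): Cs; apply; rewrite size_rcons ltnS.
  apply/andP; split; first exact: adjj.
  have nn : next (a :: b' :: s) (nth a (b' :: s) j) = nth a (rcons s a) j.
    have -> : nth a (b' :: s) j = nth a (a :: b' :: s) j.+1 by [].
    rewrite next_nth mem_nth; last exact: js.
    rewrite index_uniq // nth_rcons.
    have [js'|js'] := ltnP j (size s); first exact: set_nth_default.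
    have -> : j = size s by apply/eqP; rewrite eqn_leq js js'.
    by rewrite eqxx nth_default.
  have ej : nth a (b' :: rcons s a) j = nth a (b' :: s) j.
    by rewrite -rcons_cons nth_rcons /= ltnS js.
  rewrite ej; apply: lar.
    apply/imsetP; exists (nth a (b' :: s) j); last by rewrite nE nn.
    by rewrite memE inE mem_nth ?orbT //= ltnS.
  (* This edge differs from the removed one: it does not start at [a], and if it runs from [b'] back
     to [a], then [b'] is last on the path, which a cycle with more than two vertices excludes. *)
  rewrite -abxy; apply/eqP => /set2_eq; rewrite -nn.
  have Na : a \notin b' :: s by move: Us => /= /andP[].
  have jm : nth a (b' :: s) j \in b' :: s by apply: mem_nth.
  case=> [[e _]|[e1 e2]]; first by rewrite -e jm in Na.
  move: e2; rewrite nn nth_rcons; have [js'|js'] := ltnP j (size s).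
    by move=> e; rewrite inE -e mem_nth ?orbT in Na.
  have {js' js} js : j = size s by apply/eqP; rewrite eqn_leq js js'.
  move=> _.
  move: Us => /= /and3P[_ bs _]; move: e1; rewrite js /=.
  case: s js bs ss {adjj nE memE Cs Es nn ej Na jm} => //= z s js bs ss e1.
  by move: bs; rewrite -e1 mem_nth.
move=> [c [gc /imsetP[u uc xyu] lar]].
have /set2_eq[[xu yu]|[xu yu]] := xyu.
  by apply: (key _ _ c) => //; rewrite xu.
by rewrite csym; apply: (key _ _ c) => //; rewrite ?yu // finset.setUC.
Qed.

(** A path of smaller edges, made simple, is closed to a cycle by the edge itself. *)
Lemma below_largest_on_cycle (F : {set {set 'I_n}}) (x y : 'I_n) :
  x != y -> [set x; y] \in F -> connect (below F x y) x y ->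
  largest_on_cycle G F x y.
Proof.
move=> nxy xyF /connectP[p0 /shortenP[p Pp Up _] {p0} yE].
exists (x :: p).
(* The path is nonempty since [x != y], and it is not the single edge itself, whose rank is not
   below its own. *)
have ps : 1 < size p.
  case: p yE Pp Up => [/= yE|a [|b p]] //=; first by rewrite yE eqxx in nxy.
  by move=> -> /andP[/andP[_]]; rewrite rank_ltE ltxx.
have pth : path (adj F) x p.
  by apply: sub_path Pp => u v /andP[].
have last_next : next (x :: p) y = x.
  rewrite next_nth {1}yE mem_last yE.
  rewrite index_last // nth_default //.
have next_path j : j < size p ->
    next (x :: p) (nth x (x :: p) j) = nth x p j.
  move=> js; rewrite next_nth mem_nth; last exact: ltnW.
  by rewrite index_uniq //; apply: ltnW.
split.
- split=> //=; rewrite rcons_path pth -yE adj_sym /adj //.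
- apply/imsetP; exists y; first by rewrite yE mem_last.
  by rewrite last_next finset.setUC.
- move=> u v /imsetP[w wc uv]; rewrite uv.
  rewrite rank_ltE (rank_set2 uv).
  have wE := nth_index x wc.
  have: index w (x :: p) <= size p.
    by rewrite -ltnS -[(size p).+1]/(size (x :: p)) index_mem.
  rewrite leq_eqVlt => /orP[/eqP js|js].
    have -> : w = y by rewrite -wE js yE (last_nth x).
    by rewrite last_next finset.setUC eqxx.
  move=> _; rewrite -wE next_path //.
  by have /(pathP x)/(_ _ js)/andP[_] := Pp; rewrite rank_ltE.
Qed.

End Graph.

(** * Connectivity and sparsity of the retained edges *)

Section Sparsification.
Variables (disp : Order.disp_t) (O : orderType disp) (n : nat) (G : graph O n).

Lemma connected_of_smaller_paths (E' : {set {set 'I_n}}) :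
  connected_graph (edges G) ->
  (forall x y, y \in nbrs G x -> [set x; y] \notin E' ->
     connect (below G (edges G) x y) x y) ->
  connected_graph E'.
Proof.
move=> conG H u v; apply: connect_sub (conG u v) => {u v} a b.
rewrite adj_edges => ab.
pose bad (e : 'I_n * 'I_n) :=
  (e.2 \in nbrs G e.1) && ~~ connect (adj E') e.1 e.2.
have [//|Nab] := boolP (connect (adj E') a b).
have bad_ab : bad (a, b) by rewrite /bad ab.
have [[x y]] := @Order.TotalTheory.arg_minP _ _ _ (a, b) bad
  (fun e => rank G e.1 e.2) bad_ab.
move=> /andP[/= xy Nxy] min_xy.
suff : connect (adj E') x y by move=> c; rewrite c in Nxy.
have [xyE|xyE] := boolP ([set x; y] \in E'); first exact: connect1.
apply: connect_sub (H x y xy xyE) => u v /andP[].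
rewrite adj_edges rank_ltE => uv lt_uv.
have [//|Nuv] := boolP (connect (adj E') u v).
(* An edge of the bypass whose ends [E'] separates would be bad and of rank smaller than the
   minimum. *)
have /min_xy /= : bad (u, v) by rewrite /bad uv.
by rewrite leNgt lt_uv.
Qed.

Lemma edges_neq (x y : 'I_n) : y \in nbrs G x -> x != y.
Proof. by apply: contraTneq => ->; apply: nbrs_irrefl. Qed.

Lemma max_rank_edge (F : {set {set 'I_n}}) :
  F \subset edges G -> F != finset.set0 ->
  exists x y, [set x; y] \in F /\
    forall u v, [set u; v] \in F -> (rank G u v <= rank G x y)%O.
Proof.
move=> sF /finset.set0Pn[e eF].
have := fintype.subsetP sF _ eF; rewrite inE.
move=> /existsP[a /existsP[b /andP[/eqP eab _]]].
rewrite eab in eF.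
pose P (e : 'I_n * 'I_n) := [set e.1; e.2] \in F.
case: (@Order.TotalTheory.arg_maxP _ _ _ (a, b) P (fun e => rank G e.1 e.2) eF).
move=> [x y] /= xyF max_xy; exists x, y; split=> // u v uvF.
exact: (max_xy (u, v)).
Qed.

Section Ball.
Variables (R : realType) (k : R) (k_ge0 : (0 <= k)%R).

(** Path lengths are natural numbers, so the radius [k] can be replaced by its integer part, the
    parameter given to the program. *)
Lemma ball_leP (x u : 'I_n) :
  reflect (exists p, [/\ path (adj (edges G)) x p, last x p = u &
                         size p <= Num.truncn k])
          (u \in ball_le G k x).
Proof.
rewrite inE; apply: (iffP (asboolP _)) => -[p [Pp lp sp]]; exists p;
  by split=> //; move: sp; rewrite truncn_ge_nat.
Qed.

Lemma adj_ball_edges (x u v : 'I_n) :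
  adj (ball_edges G k x) u v =
  [&& v \in nbrs G u, u \in ball_le G k x & v \in ball_le G k x].
Proof.
rewrite /adj inE -[_ \in edges G]/(adj _ _ _) adj_edges.
by rewrite finset.subUset !finset.sub1set.
Qed.

Lemma below_ball (x y : 'I_n) :
  subrel (below G (ball_edges G k x) x y) (below G (edges G) x y).
Proof.
move=> u v /andP[]; rewrite adj_ball_edges => /and3P[uv _ _] lt_uv.
by apply/andP; rewrite adj_edges.
Qed.

(* A short path of smaller rank joining the ends of a kept edge would stay
   inside the ball and close a cycle with that edge on top. *)
Lemma sparse_of_not_largest (eps : R) (E' : {set {set 'I_n}}) :
  hyperfinite eps k G -> E' \subset edges G ->
  (forall e, e \in E' -> exists x y,
     e = [set x; y] /\ ~ largest_on_cycle G (ball_edges G k x) x y) ->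
  sparse eps E'.
Proof.
move=> [F [sF cF compF]] sE' HE'.
have : #|E' :\: F| <= n.
  (* In each nonempty subset of [E' :\: F] the edge of largest rank is shown to be a bridge. *)
  apply: card_forest => F' sF' F'0.
  have sF'E : F' \subset edges G.
    apply: fintype.subset_trans sF' _.
    by apply: fintype.subset_trans sE'; apply: finset.subsetDl.
  have [a [b [abF' max_ab]]] := max_rank_edge sF'E F'0.
  have := fintype.subsetP sF' _ abF'; rewrite inE => /andP[_ /HE'].
  move=> [x [y [Eab Nlar]]]; exists x, y; rewrite -Eab; split=> //.
  apply/negP => /connectP[p0 /shortenP[p Pp Up _] {p0} yE].
  have xyG : y \in nbrs G x.
    by rewrite -adj_edges /adj -Eab (fintype.subsetP sF'E).
  have Pe : path (adj (edges G :\: F)) x p.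
    apply: sub_path Pp => u v; rewrite /adj !inE => /andP[_ uvF'].
    have := fintype.subsetP sF' _ uvF'; rewrite inE => /andP[-> /=].
    by move=> /(fintype.subsetP sE'); rewrite inE.
  (* A simple path avoiding [F] lies in one component, so it has fewer edges than that component has
     vertices. *)
  have sp : size p < #|component (edges G :\: F) x|.
    rewrite -[(size p).+1]/(size (x :: p)) -(card_uniqP Up).
    apply: subset_leq_card; apply/fintype.subsetP => z zp.
    by rewrite inE; apply: (path_connect Pe).
  have spk : ((size p)%:R <= k)%R.
    apply: Order.POrderTheory.le_trans (compF x).
    by rewrite ler_nat ltnW.
  have ballp j : j <= size p -> nth x (x :: p) j \in ball_le G k x.
    move=> jp; rewrite inE; apply/asboolP; exists (take j p); split.
    - apply: take_path; apply: sub_path Pe => u v.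
      by rewrite /adj inE => /andP[].
    - rewrite (last_nth x) size_takel //.
      by case: j jp => //= j jp; rewrite nth_take.
    - apply: Order.POrderTheory.le_trans spk.
      by rewrite ler_nat size_takel.
  apply: Nlar; apply: below_largest_on_cycle; first exact: edges_neq.
    rewrite -/(adj _ _ _) adj_ball_edges xyG (ballp 0) //=.
    by rewrite yE (last_nth x); apply: ballp.
  apply/connectP; exists p => //; apply/(pathP x) => j js.
  move/(pathP x): Pp => /(_ j js); rewrite /adj !inE => /andP[neq inF'].
  apply/andP; split.
    rewrite adj_ball_edges (ballp j (ltnW js)) (ballp j.+1 js) /= andbT.
    by rewrite -adj_edges /adj (fintype.subsetP sF'E).
  (* Maximality gives a weak inequality; it is strict because the rank determines the edge and
     [[set x; y]] was deleted. *)
  rewrite rank_ltE -(rank_set2 G Eab) Order.POrderTheory.lt_neqAle max_ab //.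
  by rewrite andbT; apply: contraNneq neq => /rank_inj ->.
rewrite /sparse => cE'.
have -> : ((1 + eps) * n%:R = n%:R + eps * n%:R :> R)%R by rewrite mulrDl mul1r.
apply: (@Order.POrderTheory.le_trans _ _ (#|E' :\: F|%:R + #|F|%:R)%R).
  rewrite -natrD ler_nat -(cardsID F E') addnC leq_add2l.
  by rewrite subset_leq_card // finset.subsetIr.
by apply: lerD => //; rewrite ler_nat.
Qed.

End Ball.

(** * Size of balls in graphs of bounded degree *)

Section BallCard.
Variables (d : nat) (dG : degree_bounded d G) (x : 'I_n).

(** Adding the root at each level makes this contain the ball of radius [K], while its size obeys
    [b (K + 1) <= d * b K + 1]. *)
Fixpoint nball (K : nat) : {set 'I_n} :=
  if K is K'.+1 then x |: \bigcup_(v in nball K') [set u in nbrs G v]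
  else [set x].

Lemma mem_nball (K : nat) (p : seq 'I_n) :
  path (adj (edges G)) x p -> size p <= K -> last x p \in nball K.
Proof.
elim: K p => [|K IH] p; first by case: p => //= _ _; rewrite inE.
case/lastP: p => [|p u]; first by rewrite /= !inE eqxx.
rewrite rcons_path last_rcons size_rcons ltnS adj_edges => /andP[Pp pu] sp.
rewrite /= finset.in_setU; apply/orP; right; apply/bigcupP; exists (last x p).
  exact: IH.
by rewrite inE.
Qed.

Lemma card_nball_rec (K : nat) : #|nball K.+1| <= (d * #|nball K|).+1.
Proof.
rewrite /= cardsU1; apply: (@leq_add _ _ 1); first exact: leq_b1.
rewrite mulnC -sum_nat_const.
apply: (big_ind2 (fun (A : {set 'I_n}) m => #|A| <= m)).
- by rewrite cards0.
- move=> A a B b Aa Bb; apply: leq_trans (leq_add Aa Bb).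
  by rewrite cardsU leq_subr.
- move=> v _; rewrite cardsE; apply: leq_trans (dG v); exact: card_size.
Qed.

Lemma card_nball (y : 'I_n) (K : nat) :
  y \in nbrs G x -> #|nball K| <= 2 * d ^ K.
Proof.
move=> xy; have d0 : 0 < d.
  by apply: leq_trans (dG x); case: (nbrs G x) xy.
have [d1|d1] := leqP d 1.
  have {d0}d1 : d = 1 by lia.
  (* In degree one neighbours are unique, so [[set x; y]] is closed under adjacency. *)
  have nb1 u v : u \in nbrs G v -> forall w, w \in nbrs G v -> w = u.
    have := dG v; rewrite d1; case: (nbrs G v) => [|a [|b s]] //= _.
    by rewrite inE => /eqP -> w; rewrite inE => /eqP.
  rewrite d1 exp1n muln1; apply: (@leq_trans #|[set x; y]|).
    apply: subset_leq_card; elim: K => [|K IH] /=.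
      by rewrite finset.sub1set !inE eqxx.
    rewrite finset.subUset finset.sub1set !inE eqxx /=.
    apply/bigcupsP => v /(fintype.subsetP IH); rewrite !inE => vxy.
    apply/fintype.subsetP => u; rewrite !inE.
    case/orP: vxy => /eqP -> uv.
      by rewrite (nb1 _ _ xy _ uv) eqxx orbT.
    have yx : x \in nbrs G y by rewrite nbrs_sym.
    by rewrite (nb1 _ _ yx _ uv) eqxx.
  by rewrite cards2; case: (_ != _).
(* The strict bound carries the induction: [d * (2 * d ^ K - 1) + 1 < 2 * d ^ K.+1] because
   [d >= 2]. *)
suff: #|nball K| < 2 * d ^ K by lia.
elim: K => [|K IH]; first by rewrite /= cards1.
apply: leq_ltn_trans (card_nball_rec K) _; rewrite expnS; nia.
Qed.

End BallCard.
End Sparsification.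

(** * Queue searches *)

(* A scan that handles the entries of every queued vertex in turn has handled
   entry j of vertex number a when it stands at entry i of vertex number h. *)
Definition handled (h i a j : nat) : bool := (a < h) || ((a == h) && (j < i)).

Section Search.
Variables (disp : Order.disp_t) (O : orderType disp) (n : nat) (G : graph O n).
Variables (x : 'I_n).

Lemma handledS (h i a j : nat) :
  handled h i.+1 a j -> handled h i a j \/ (a = h /\ j = i).
Proof. rewrite /handled; lia. Qed.

(** * Invariant of the breadth-first search *)

Section Bfs.
Variable (K : nat).

(** [Q] lists all discovered vertices, [h] is the position of the head, and [D] is one more than the
    depth, with 0 for undiscovered vertices. [bfs_path] gives soundness and [bfs_closed]
    completeness; the latter stops at [D = K.+1], where vertices discover nothing. Depths grow along
    the queue and exceed that of the head by at most one. *)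
Record bfs_inv (Q : seq 'I_n) (D : 'I_n -> nat) (h i : nat) : Prop := BfsInv {
  bfs_uniq : uniq Q;
  bfs_root : D x = 1;
  bfs_depth_gt0 : forall v, (0 < D v) = (v \in Q);
  bfs_depth_le : forall v, D v <= K.+1;
  bfs_path : forall v, v \in Q ->
    exists p, [/\ path (adj (edges G)) x p, last x p = v & size p < D v];
  bfs_sorted : forall a b, a <= b -> b < size Q ->
    D (nth x Q a) <= D (nth x Q b);
  bfs_window : h < size Q -> forall a, a < size Q ->
    D (nth x Q a) <= (D (nth x Q h)).+1;
  bfs_closed : forall a j, handled h i a j -> a < size Q ->
    j < size (nbrs G (nth x Q a)) -> D (nth x Q a) <= K ->
    0 < D (nth x (nbrs G (nth x Q a)) j) <= (D (nth x Q a)).+1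
}.

Lemma bfs_inv_init : bfs_inv [:: x] (fun v => v == x) 0 0.
Proof.
split=> //=.
- by rewrite eqxx.
- by move=> v; rewrite inE lt0b.
- by move=> v; case: eqP.
- by move=> v; rewrite inE => /eqP ->; exists [::]; split=> //=; rewrite eqxx.
- by move=> [|a] [|b] //=.
- by move=> _ [|a] //= _; rewrite eqxx.
- by move=> a j; rewrite /handled ltn0 andbF.
Qed.

Lemma bfs_inv_old (Q : seq 'I_n) (D : 'I_n -> nat) (h i : nat) :
  h < size Q -> i < size (nbrs G (nth x Q h)) ->
  (D (nth x (nbrs G (nth x Q h)) i) == 0) && (D (nth x Q h) <= K) = false ->
  bfs_inv Q D h i -> bfs_inv Q D h i.+1.
Proof.
move=> hQ iN nD [H1 H2 H3 H4 H5 H6 H7 H8]; split=> //.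
move=> a j /handledS [|[-> ->]]; first exact: H8.
move=> _ _ le_K; move: nD; rewrite le_K andbT => /eqP nD.
have uQ : nth x (nbrs G (nth x Q h)) i \in Q by rewrite -H3 lt0n; apply/eqP.
(* The neighbour is in the queue already, so the window bounds its depth. *)
have := H7 hQ (index (nth x (nbrs G (nth x Q h)) i) Q).
by rewrite index_mem nth_index // => /(_ uQ) ->; rewrite H3 uQ.
Qed.

Lemma bfs_inv_new (Q : seq 'I_n) (D D' : 'I_n -> nat) (h i : nat) :
  h < size Q -> i < size (nbrs G (nth x Q h)) ->
  D (nth x (nbrs G (nth x Q h)) i) = 0 -> D (nth x Q h) <= K ->
  (forall v, D' v = if v == nth x (nbrs G (nth x Q h)) i
                    then (D (nth x Q h)).+1 else D v) ->
  bfs_inv Q D h i -> bfs_inv (rcons Q (nth x (nbrs G (nth x Q h)) i)) D' h i.+1.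
Proof.
set v := nth x Q h; set u := nth x (nbrs G v) i.
move=> hQ iN Du0 DvK DE' [H1 H2 H3 H4 H5 H6 H7 H8].
have uQ : u \notin Q by rewrite -H3 Du0.
have uE : D' u = (D v).+1 by rewrite DE' eqxx.
have DE w : w \in Q -> D' w = D w.
  by move=> wQ; rewrite DE'; case: eqP => // wu; rewrite -wu wQ in uQ.
have nthE a : a < size Q -> nth x (rcons Q u) a = nth x Q a.
  by move=> aQ; rewrite nth_rcons aQ.
have DnE a : a < size Q -> D' (nth x (rcons Q u) a) = D (nth x Q a).
  by move=> aQ; rewrite nthE // DE // mem_nth.
have DuE : D' (nth x (rcons Q u) (size Q)) = (D v).+1.
  by rewrite nth_rcons ltnn eqxx.
have vQ : v \in Q by rewrite mem_nth.
have case_lt a : a < size (rcons Q u) -> a < size Q \/ a = size Q.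
  by rewrite size_rcons; lia.
split.
- by rewrite rcons_uniq uQ.
- by rewrite DE // -H3 H2.
- move=> w; rewrite DE' mem_rcons inE; case: eqP => //= _; exact: H3.
- by move=> w; rewrite DE'; case: eqP => // _.
- move=> w; rewrite mem_rcons inE => /orP[/eqP ->|wQ].
    have [p [Pp lp sp]] := H5 v vQ; exists (rcons p u); split.
    + by rewrite rcons_path Pp lp adj_edges mem_nth.
    + by rewrite last_rcons.
    + by rewrite uE size_rcons.
  by have [p [Pp lp sp]] := H5 w wQ; exists p; rewrite DE.
- move=> a b le_ab /case_lt[] bQ.
    by rewrite !DnE ?H6 //; lia.
  (* The appended depth is one more than that of the head, the most that the window allows. *)
  have [aQ|aQ] := ltnP a (size Q).
    by rewrite bQ DnE // DuE H7.
  by rewrite (_ : a = b) //; lia.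
- move=> _ a /case_lt[] aQ; rewrite (DnE h) //.
    by rewrite DnE // H7.
  by rewrite aQ DuE.
- move=> a j /handledS [H|[-> ->]].
    move=> /case_lt[] aQ; last by move: H; rewrite /handled; lia.
    rewrite nthE // => jN; rewrite (DE (nth x Q a)) ?mem_nth // => aK.
    have /andP[w0 wle] := H8 a j H aQ jN aK.
    by rewrite DE -?H3 // w0.
  by rewrite nthE // -/v => _ _ _; rewrite uE DE // ltnSn.
Qed.

Lemma bfs_inv_next (Q : seq 'I_n) (D : 'I_n -> nat) (h : nat) :
  h < size Q ->
  bfs_inv Q D h (size (nbrs G (nth x Q h))) -> bfs_inv Q D h.+1 0.
Proof.
move=> hQ [H1 H2 H3 H4 H5 H6 H7 H8]; split=> //.
  (* By sortedness the new head is at least as deep as the old one, so the window persists. *)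
  move=> hQ' a aQ; apply: leq_trans (H7 hQ a aQ) _.
  by rewrite ltnS; apply: H6.
move=> a j; rewrite /handled => /orP[|/andP[_ //]]; rewrite ltnS => ah aQ jN.
apply: H8 => //; rewrite /handled; move: ah; rewrite leq_eqVlt.
by case/orP=> [/eqP <-|->] //; rewrite eqxx jN orbT.
Qed.

Lemma bfs_inv_done (Q : seq 'I_n) (D : 'I_n -> nat) (v : 'I_n) :
  bfs_inv Q D (size Q) 0 ->
  v \in Q <->
  exists p, [/\ path (adj (edges G)) x p, last x p = v & size p <= K].
Proof.
move=> [H1 H2 H3 H4 H5 H6 H7 H8]; split.
  move=> /H5[p [Pp lp sp]]; exists p; split=> //.
  by rewrite -ltnS (leq_trans sp).
move=> [p [Pp <- sp]].
(* The depth bound is part of the induction: it keeps [D] at most [K] at the last vertex but one,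
   where [bfs_closed] applies. *)
suff : 0 < D (last x p) <= (size p).+1 by rewrite H3 => /andP[].
elim/last_ind: p Pp sp => [_ _|p u IH]; first by rewrite /= H2.
rewrite rcons_path size_rcons last_rcons adj_edges => /andP[Pp pu] sp.
have /andP[w0 wle] := IH Pp (ltnW sp).
set w := last x p in pu w0 wle *.
have wQ : w \in Q by rewrite -H3.
have := H8 (index w Q) (index u (nbrs G w)).
rewrite /handled index_mem wQ nth_index // index_mem pu nth_index //.
move=> /(_ isT isT isT (leq_trans wle sp)) /andP[-> ule] /=; lia.
Qed.

End Bfs.

(** * Invariant of the search for reachable vertices *)

Section Closure.
Variable (r : rel 'I_n).

Record closure_inv (Q : seq 'I_n) (h i : nat) : Prop := ClosureInv {
  closure_uniq : uniq Q;
  closure_root : x \in Q;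
  closure_connect : forall v, v \in Q -> connect r x v;
  closure_closed : forall a j, handled h i a j -> a < size Q ->
    j < size (nbrs G (nth x Q a)) ->
    r (nth x Q a) (nth x (nbrs G (nth x Q a)) j) ->
    nth x (nbrs G (nth x Q a)) j \in Q
}.

Lemma closure_inv_init : closure_inv [:: x] 0 0.
Proof.
split=> //=; first by rewrite inE.
- by move=> v; rewrite inE => /eqP ->.
- by move=> a j; rewrite /handled ltn0 andbF.
Qed.

Lemma closure_inv_old (Q : seq 'I_n) (h i : nat) :
  (r (nth x Q h) (nth x (nbrs G (nth x Q h)) i) ->
   nth x (nbrs G (nth x Q h)) i \in Q) ->
  closure_inv Q h i -> closure_inv Q h i.+1.
Proof.
move=> old [H1 H2 H3 H4]; split=> //.
by move=> a j /handledS [|[-> -> _ _]]; [exact: H4|].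
Qed.

Lemma closure_inv_new (Q : seq 'I_n) (h i : nat) :
  h < size Q ->
  r (nth x Q h) (nth x (nbrs G (nth x Q h)) i) ->
  nth x (nbrs G (nth x Q h)) i \notin Q ->
  closure_inv Q h i ->
  closure_inv (rcons Q (nth x (nbrs G (nth x Q h)) i)) h i.+1.
Proof.
set v := nth x Q h; set u := nth x (nbrs G v) i.
move=> hQ vu uQ [H1 H2 H3 H4].
have nthE a : a < size Q -> nth x (rcons Q u) a = nth x Q a.
  by move=> aQ; rewrite nth_rcons aQ.
split.
- by rewrite rcons_uniq uQ.
- by rewrite mem_rcons inE H2 orbT.
- move=> w; rewrite mem_rcons inE => /orP[/eqP ->|]; last exact: H3.
  by apply: connect_trans (connect1 vu); apply: H3; rewrite mem_nth.
- move=> a j /handledS [H aQ|[-> ->]].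
    have {}aQ : a < size Q by move: H aQ; rewrite /handled size_rcons; lia.
    by rewrite nthE // => jN rr; rewrite mem_rcons inE H4 ?orbT.
  by rewrite nthE // -/v => _ _ _; rewrite mem_rcons inE eqxx.
Qed.

Lemma closure_inv_next (Q : seq 'I_n) (h : nat) :
  h < size Q ->
  closure_inv Q h (size (nbrs G (nth x Q h))) -> closure_inv Q h.+1 0.
Proof.
move=> hQ [H1 H2 H3 H4]; split=> //.
move=> a j; rewrite /handled => /orP[|/andP[_ //]]; rewrite ltnS => ah aQ jN.
apply: H4 => //; rewrite /handled; move: ah; rewrite leq_eqVlt.
by case/orP=> [/eqP <-|->] //; rewrite eqxx jN orbT.
Qed.

(** A set that contains [x] and is closed under [r] contains everything reachable. As [r] lies
    inside adjacency, each of its steps occurs among the scanned neighbours. *)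
Lemma closure_inv_done (Q : seq 'I_n) (v : 'I_n) :
  (forall u w, r u w -> w \in nbrs G u) ->
  closure_inv Q (size Q) 0 -> (v \in Q) = connect r x v.
Proof.
move=> rG [H1 H2 H3 H4]; apply/idP/idP; first exact: H3.
move=> /connectP[p Pp ->] {v}.
elim/last_ind: p Pp => [//|p u IH]; rewrite rcons_path last_rcons.
move=> /andP[/IH wQ wu]; set w := last x p in wQ wu.
have := H4 (index w Q) (index u (nbrs G w)).
rewrite /handled index_mem wQ nth_index // index_mem (rG _ _ wu).
by rewrite nth_index ?rG //; apply.
Qed.

End Closure.
End Search.

(** * The program *)

(** Symbolic execution of straight-line code; conditionals and loops call for a case split or an
    invariant. *)
Ltac run_step :=
  lazymatch goal with
  | |- halts_in _ (Seq _ _) _ _ => apply: halts_in_seq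
  | |- halts_in _ Skip _ _ => apply: halts_in_skip
  | |- halts_in _ (Set_ _ _ _) _ _ =>
      eapply halts_in_set; [by rewrite /update /=; reflexivity
                           |by rewrite /update /=; reflexivity|]
  | |- halts_in _ (Query _ _ _) _ _ =>
      eapply halts_in_query; [by rewrite /update /=; reflexivity
                             |by rewrite /update /=; reflexivity|]
  | |- halts_in _ (assign _ _) _ _ => rewrite /assign
  | |- halts_in _ (incr _) _ _ => rewrite /incr
  | |- halts_in _ (block _) _ _ => rewrite /block [foldr _ _ _]/=
  end.

Section Oracle.
Variables (disp : Order.disp_t) (O : orderType disp) (n : nat) (G : graph O n).

Lemma graph_oracle_neighbor (x v : 'I_n) (i : nat) :
  neighbor (graph_oracle G) v i =
  if i < size (nbrs G v) then (nth x (nbrs G v) i).+1 else 0.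
Proof.
rewrite /= valK; case: ltnP => iN; last by rewrite onth_default.
by rewrite onthE (nth_map x).
Qed.

Lemma graph_oracle_id_lt (u v : 'I_n) :
  id_lt (graph_oracle G) u v = (vid G u < vid G v)%O.
Proof. by rewrite /= !valK. Qed.

End Oracle.

(** * Correctness and cost of the breadth-first search *)

Section BfsProgram.
Variables (disp : Order.disp_t) (O : orderType disp) (n : nat) (G : graph O n).
Variables (x y : 'I_n) (K : nat).
(* Simplification would unfold the concrete oracle, hence an abstract one. *)
Variable orc : oracle.
Hypothesis neighborE : forall (v : 'I_n) i, neighbor orc v i =
  if i < size (nbrs G v) then (nth x (nbrs G v) i).+1 else 0.

(** How the memory represents the ghost queue [Q] and depths [D]. Handled adjacency entries lie
    below [ptr_], so later writes at [ptr_] preserve them. [bmem_mark] hands a clean [MARK] array to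
    the second search. *)
Record bfs_mem (Q : seq 'I_n) (D : 'I_n -> nat) (h i : nat) (m : memory) :
    Prop := BfsMem {
  bmem_x : m INPUT 1 = x;
  bmem_y : m INPUT 2 = y;
  bmem_k : m INPUT 3 = K;
  bmem_mark : forall j, m MARK j = 0;
  bmem_queue : forall a, a < size Q -> m QUEUE a = nth x Q a;
  bmem_head : m head_ 0 = h;
  bmem_tail : m tail_ 0 = size Q;
  bmem_depth : forall v : 'I_n, m DEPTH v = D v;
  bmem_adj : forall a j, handled h i a j -> a < size Q ->
    j < size (nbrs G (nth x Q a)) ->
    m FIRST (nth x Q a) + j < m ptr_ 0 /\
    m ADJ (m FIRST (nth x Q a) + j) = nth x (nbrs G (nth x Q a)) j;
  bmem_last : forall a, a < h -> a < size Q ->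
    m LAST (nth x Q a) = m FIRST (nth x Q a) + size (nbrs G (nth x Q a))
}.

(** [P] is the value of [ptr_] when the scan of [v] began, the number of entries stored so far. Each
    of the [h] finished vertices cost one query per entry and a final failing one; the last query
    for [v] adds one more. *)
Record bfs_scan (v : 'I_n) (h P i : nat) (s : state) : Prop := BfsScan {
  scan_inv : exists Q D, [/\ bfs_inv G x K Q D h i, bfs_mem Q D h i (cells s),
    h < size Q & nth x Q h = v];
  scan_le : i <= size (nbrs G v);
  scan_v : cells s v_ 0 = v;
  scan_i : cells s i_ 0 = i;
  scan_w : cells s w_ 0 = neighbor orc v i;
  scan_ptr : cells s ptr_ 0 = P + i;
  scan_first : cells s FIRST v = P;
  scan_queries : queries s = (h + P + i).+1;
  scan_steps : steps s <= 150 + 100 * h + 100 * (P + i)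
}.

Record bfs_outer (d h : nat) (s : state) : Prop := BfsOuter {
  outer_inv : exists Q D, [/\ bfs_inv G x K Q D h 0, bfs_mem Q D h 0 (cells s) &
    h <= size Q];
  outer_ptr : cells s ptr_ 0 <= d * h;
  outer_queries : queries s = h + cells s ptr_ 0;
  outer_steps : steps s <= 100 + 100 * h + 100 * cells s ptr_ 0
}.

Lemma bfs_correct (d : nat) (tape : nat -> nat) :
  degree_bounded d G ->
  halts_in orc bfs (State (initial_memory n [:: K] tape x y) 0 0)
    (fun s => exists Q D, [/\ bfs_inv G x K Q D (size Q) 0,
       bfs_mem Q D (size Q) 0 (cells s),
       queries s <= size Q * d.+1 & steps s <= 150 + 100 * (size Q * d.+1)]).
Proof.
move=> dG; rewrite /bfs.
do !run_step.
(* The queue has no repetitions, hence at most [n] iterations. *)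
apply: (@halts_in_while _ _ _ (bfs_outer d) 0 n).
- move=> h s [[Q [D [inv mem _]]] _ _ _] /=.
  rewrite (bmem_head mem) (bmem_tail mem) => hQ; apply: leq_trans hQ _.
  by rewrite -(card_uniqP (bfs_uniq inv)) (leq_trans (max_card _)) ?card_ord.
- move=> h [m q t] [[Q [D [inv /= mem _]]] /= Ptr Pq Pt].
  rewrite (bmem_head mem) (bmem_tail mem) => hQ; rewrite /tick /=.
  set v := nth x Q h; set P := m ptr_ 0 in Ptr Pq Pt.
  run_step; run_step; rewrite (bmem_head mem) (bmem_queue mem hQ) -/v.
  do !run_step; rewrite -/P.
  apply: (@halts_in_while _ _ _ (bfs_scan v h P) 0 (size (nbrs G v))).
  + move=> i s [_ _ _ _ /= -> _ _ _ _]; rewrite neighborE.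
    by have [|] := ltnP i (size (nbrs G v)).
  + clearbody v P; move=> {Q D inv mem Ptr Pq Pt hQ m q t} i [m q t].
    move=> [[Q [D [inv /= mem hQ vE]]] _ /= mv mi mw mptr mfirst Pq Pt].
    rewrite mw neighborE; have [iN _|] := ltnP i (size (nbrs G v)); last by [].
    rewrite /tick /=.
    set u := nth x (nbrs G v) i in mw *.
    run_step; run_step; rewrite mw neighborE iN subn1 [_.-1]/=.
    do !run_step.
    rewrite mptr -/u.
    apply: halts_in_if.
    rewrite /tick [cells _]/= [holds _ _ _]/=.
    rewrite (_ : _ && _ = (D u == 0) && (D v <= K)); last first.
      by rewrite /update /= mv (bmem_k mem) !(bmem_depth mem) addn1 ltnS.
    (* Stated for any [Q'] agreeing with [Q] up to the head, to serve whether or not the neighbour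
       is appended. The write at [P + i] adds entry [i] of [v] and misses all earlier ones. *)
    have adjH (Q' : seq 'I_n) : (forall a, a <= h -> nth x Q' a = nth x Q a) ->
        forall a j, handled h i.+1 a j -> j < size (nbrs G (nth x Q' a)) ->
        m FIRST (nth x Q' a) + j < P + i + 1 /\
        (if m FIRST (nth x Q' a) + j == P + i then nat_of_ord u
         else m ADJ (m FIRST (nth x Q' a) + j)) = nth x (nbrs G (nth x Q' a)) j.
      move=> QE a j /handledS [H|[-> ->]].
        have ah : a <= h by move: H; rewrite /handled; lia.
        rewrite QE // => jN.
        have [|lt_ptr adjE] := bmem_adj mem H _ jN; first lia.
        by rewrite mptr in lt_ptr; rewrite adjE; split; [|case: eqP]; lia.
      rewrite QE // vE mfirst eqxx => _; split=> //; lia.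
    have lastH (Q' : seq 'I_n) : (forall a, a <= h -> nth x Q' a = nth x Q a) ->
        forall a, a < h -> m LAST (nth x Q' a) =
        m FIRST (nth x Q' a) + size (nbrs G (nth x Q' a)).
      by move=> QE a ah; rewrite QE ?(bmem_last mem) //; lia.
    have [/andP[/eqP Du0 DvK]|] := boolP (_ && _); last first.
      move=> /negbTE Nb.
      do !run_step; split=> //.
      - exists Q, D; split=> //.
          by apply: bfs_inv_old => //; rewrite vE.
        case: mem => H1 H2 H3 H4 H5 H6 H7 H8 _ _.
        by split=> // a; rewrite /update /= ?mptr; [move=> j Hh _; apply: adjH|
          move=> ah _; apply: lastH].
      - by rewrite /update /= mi addn1.
      - by rewrite /update /= mv mi addn1.
      - by rewrite /update /= addn1 addnS.
      - by rewrite /= Pq addnS.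
      - rewrite /=; lia.
    do !run_step; split=> //.
    - exists (rcons Q u), (fun w => if w == u then (D v).+1 else D w).
      have QE a : a <= h -> nth x (rcons Q u) a = nth x Q a.
        by move=> ah; rewrite nth_rcons (leq_ltn_trans ah hQ).
      split=> //.
      + have := @bfs_inv_new _ _ _ G x K Q D
          (fun w => if w == u then (D v).+1 else D w) h i.
        by rewrite vE -/u; apply.
      + case: mem => H1 H2 H3 H4 H5 H6 H7 H8 _ _.
        split=> //.
        * move=> a; rewrite size_rcons /update /= H7 nth_rcons => aQ.
          case: eqP => [->|]; first by rewrite ltnn.
          by move=> aN; rewrite ifT ?H5 //; lia.
        * by rewrite /update /= H7 size_rcons addn1.
        * move=> w; rewrite /update /= mv !H8 addn1 val_eqE.
          by case: eqP.
        * by move=> a j Hh _; rewrite /update /=; apply: adjH.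
        * by move=> a ah _; rewrite /update /=; apply: lastH.
      + by rewrite size_rcons ltnW.
      + by rewrite QE.
    - by rewrite /update /= mi addn1.
    - by rewrite /update /= mv mi addn1.
    - by rewrite /update /= addn1 addnS.
    - by rewrite /= Pq addnS.
    - rewrite /=; lia.
  + clearbody v P; move=> {Q D inv mem Pq Pt hQ m q t} i [m q t].
    move=> [[Q [D [inv /= mem hQ vE]]] iN /= mv mi mw mptr mfirst Pq Pt].
    rewrite mw neighborE; have [//|iN' _] := ltnP i (size (nbrs G v)).
    have {iN iN'} iE : i = size (nbrs G v) by lia.
    rewrite /tick /=; do !run_step; split.
    - exists Q, D; split=> //.
        by apply: bfs_inv_next; rewrite ?vE -?iE.
      (* Writing [LAST] at [v] leaves finished vertices alone, as the queue has no repetitions. *)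
      have neq a : a < h -> (nth x Q a == v :> nat) = false.
        move=> ah; rewrite -vE val_eqE nth_uniq ?(bfs_uniq inv) ?ltn_eqF //.
        exact: ltn_trans hQ.
      case: mem => H1 H2 H3 H4 H5 H6 H7 H8 H9 H10; split=> //.
      + by rewrite /update /= H6 addn1.
      + move=> a j Hh aQ jN; rewrite /update /=; apply: H9 => //.
        move: Hh; rewrite /handled ltn0 andbF orbF ltnS leq_eqVlt.
        by case/orP=> [/eqP aE|->] //; rewrite aE eqxx iE -vE -aE jN orbT.
      + move=> a; rewrite ltnS leq_eqVlt /update /= mv.
        case/orP=> [/eqP -> _|ah aQ]; first by rewrite vE eqxx mptr mfirst iE.
        by rewrite neq // H10.
    - rewrite /update /= mptr iE; have := dG v; lia.
    - by rewrite /update /= Pq mptr; lia.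
    - rewrite /update /= mptr; lia.
  + have neq a : a < h -> (nth x Q a == v :> nat) = false.
      move=> ah; rewrite val_eqE nth_uniq ?(bfs_uniq inv) ?ltn_eqF //.
      exact: ltn_trans hQ.
    split=> //; rewrite /update /= ?eqxx //.
    - exists Q, D; split=> //.
      case: mem => H1 H2 H3 H4 H5 H6 H7 H8 H9 H10; split=> //.
        move=> a j Hh aQ; rewrite neq /=; first exact: H9.
        by move: Hh; rewrite /handled ltn0 andbF orbF.
      by move=> a ah aQ; rewrite /= neq // H10.
    - by rewrite addn0.
    - by rewrite Pq; lia.
    - rewrite addn0; lia.
- move=> h [m q t] [[Q [D [inv /= mem hQ]]] /= Ptr Pq Pt].
  rewrite (bmem_head mem) (bmem_tail mem) => hQ'.
  have hE : h = size Q by lia.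
  rewrite {h}hE in inv mem Ptr Pq Pt {hQ hQ'}.
  run_step; exists Q, D; split=> //=; nia.
- split=> //=.
  + exists [:: x], (fun v => v == x); split=> //; first exact: bfs_inv_init.
    split=> //.
    * by case.
    * by move=> a j; rewrite /handled ltn0 andbF.
Qed.

End BfsProgram.

(** * Correctness and cost of the cycle search *)

Section CycleSearch.
Variables (disp : Order.disp_t) (O : orderType disp) (n : nat) (G : graph O n).
Variables (x y : 'I_n).
Variable orc : oracle.
Hypothesis id_ltE : forall u v : 'I_n,
  id_lt orc u v = (vid G u < vid G v)%O.

Definition low_end (u v : 'I_n) := if (vid G v < vid G u)%O then v else u.
Definition high_end (u v : 'I_n) := if (vid G v < vid G u)%O then u else v.

(** The program tests equality of vertex names where ranks compare ids; the two agree because ids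
    are distinct. *)
Lemma rank_lt_ends (u v u' v' : 'I_n) :
  rank_lt G u v u' v' =
  (vid G (low_end u v) < vid G (low_end u' v'))%O ||
  (low_end u v == low_end u' v' :> nat) &&
  (vid G (high_end u v) < vid G (high_end u' v'))%O.
Proof.
have minE a b : Order.min (vid G a) (vid G b) = vid G (low_end a b).
  by rewrite minElt /low_end; case: ltgtP.
have maxE a b : Order.max (vid G a) (vid G b) = vid G (high_end a b).
  by rewrite maxElt /high_end; case: ltgtP.
by rewrite /rank_lt !minE !maxE (inj_eq (@vid_inj _ _ _ G)) val_eqE.
Qed.

(** [lo] is written before the second expression is read, hence the hypotheses on [update m lo 0 c].
    Both branches have the same cost. *)
Lemma sort_ids_correct (lo hi : nat) (e1 e2 : expr) (u v : 'I_n) (m : memory)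
    (q t : nat) (P : state -> Prop) :
  Defs.eval m e1 = u -> Defs.eval m e2 = v ->
  (forall c, Defs.eval (update m lo 0 c) e1 = u) ->
  (forall c, Defs.eval (update m lo 0 c) e2 = v) ->
  P (State (update (update m lo 0 (low_end u v)) hi 0 (high_end u v)) q
       (t + (2 * (expr_cost e1 + expr_cost e2) + 6))) ->
  halts_in orc (sort_ids lo hi e1 e2) (State m q t) P.
Proof.
move=> E1 E2 F1 F2; rewrite /low_end /high_end => HP.
apply: halts_in_if; rewrite /tick /= E1 E2 id_ltE.
case: ifP HP => _ HP; apply: halts_in_seq.
  apply: (@halts_in_set _ _ _ _ 0 v) => //.
  apply: (@halts_in_set _ _ _ _ 0 u) => //=.
  by move: HP; congr (P (State _ _ _)); lia.
apply: (@halts_in_set _ _ _ _ 0 u) => //.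
apply: (@halts_in_set _ _ _ _ 0 v) => //=.
by move: HP; congr (P (State _ _ _)); lia.
Qed.

Variable Q : seq 'I_n.

(** For [Q] the ball around [x] this is [below] in the induced subgraph. With [Q] arbitrary, the
    search is verified independently of the breadth-first one. *)
Definition search_rel : rel 'I_n :=
  [rel u v | [&& v \in nbrs G u, u \in Q, v \in Q & rank_lt G u v x y]].

Record search_mem (Q2 : seq 'I_n) (h : nat) (m : memory) : Prop := SearchMem {
  smem_x : m INPUT 1 = x;
  smem_y : m INPUT 2 = y;
  smem_depth : forall v : 'I_n, (0 < m DEPTH v) = (v \in Q);
  smem_last : forall v : 'I_n, v \in Q ->
    m LAST v = m FIRST v + size (nbrs G v);
  smem_adj : forall (v : 'I_n) j, v \in Q -> j < size (nbrs G v) ->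
    m ADJ (m FIRST v + j) = nth x (nbrs G v) j;
  smem_lo : m lo_ 0 = low_end x y;
  smem_hi : m hi_ 0 = high_end x y;
  smem_mark : forall v : 'I_n, m MARK v = (v \in Q2);
  smem_queue : forall a, a < size Q2 -> m QUEUE2 a = nth x Q2 a;
  smem_head : m head_ 0 = h;
  smem_tail : m tail_ 0 = size Q2
}.

Record search_scan (v : 'I_n) (q T h i : nat) (s : state) : Prop := SearchScan {
  sscan_inv : exists Q2, [/\ closure_inv G x search_rel Q2 h i,
    search_mem Q2 h (cells s), h < size Q2 & nth x Q2 h = v];
  sscan_le : i <= size (nbrs G v);
  sscan_v : cells s v_ 0 = v;
  sscan_i : cells s i_ 0 = cells s FIRST v + i;
  sscan_queries : queries s = q;
  sscan_steps : steps s <= T + 100 * i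
}.

Record search_outer (d q T h : nat) (s : state) : Prop := SearchOuter {
  souter_inv : exists Q2, [/\ closure_inv G x search_rel Q2 h 0,
    search_mem Q2 h (cells s) & h <= size Q2];
  souter_queries : queries s = q;
  souter_steps : steps s <= T + 100 * (h * d.+1)
}.

Lemma connect_search_rel (v : 'I_n) :
  x \in Q -> connect search_rel x v -> v \in Q.
Proof.
move=> xQ /connectP[p Pp ->] {v}.
elim/last_ind: p Pp => [//|p u _]; rewrite rcons_path last_rcons.
by move=> /andP[_ /and4P[]].
Qed.

(** The search runs on the stored adjacency lists, so it makes no queries; it visits only vertices
    of [Q], each at a cost proportional to [d.+1]. *)
Lemma cycle_search_correct (d : nat) (m : memory) (q t : nat) :
  degree_bounded d G -> x \in Q ->
  m INPUT 1 = x -> m INPUT 2 = y -> (forall j, m MARK j = 0) ->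
  (forall v : 'I_n, (0 < m DEPTH v) = (v \in Q)) ->
  (forall v : 'I_n, v \in Q -> m LAST v = m FIRST v + size (nbrs G v)) ->
  (forall (v : 'I_n) j, v \in Q -> j < size (nbrs G v) ->
     m ADJ (m FIRST v + j) = nth x (nbrs G v) j) ->
  halts_in orc cycle_search (State m q t)
    (fun s => [/\ forall v : 'I_n, cells s MARK v = connect search_rel x v,
       cells s INPUT 2 = y, queries s = q &
       steps s <= t + 200 + 100 * (size Q * d.+1)]).
Proof.
move=> dG xQ mx my mmark mdepth mlast madj; rewrite /cycle_search.
run_step; run_step.
apply: (@sort_ids_correct _ _ _ _ x y) => //; rewrite [_ + 6]/=.
do !run_step; rewrite mx.
apply: (@halts_in_while _ _ _ (search_outer d q (t + 100)) 0 n).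
- move=> h s [[Q2 [inv mem _]] _ _] /=.
  rewrite (smem_head mem) (smem_tail mem) => hQ; apply: leq_trans hQ _.
  rewrite -(card_uniqP (closure_uniq inv)).
  by rewrite (leq_trans (max_card _)) ?card_ord.
- move=> h {m mx my mmark mdepth mlast madj} [m q' t'].
  move=> [[Q2 [inv /= mem _]] /= Pq Pt].
  rewrite (smem_head mem) (smem_tail mem) => hQ; rewrite /tick /=.
  set v := nth x Q2 h.
  run_step; run_step; rewrite (smem_head mem) (smem_queue mem hQ) -/v.
  do !run_step.
  (* Reachable vertices lie in [Q], so the adjacency list of [v] has been stored. *)
  have vQ : v \in Q.
    apply: connect_search_rel => //; apply: (closure_connect inv).
    by rewrite mem_nth.
  apply: (@halts_in_while _ _ _
    (search_scan v q (t + 150 + 100 * (h * d.+1)) h) 0 (size (nbrs G v))).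
  + move=> i s [[Q2' [_ mem' _ _]] _ /= -> -> _ _].
    by rewrite (smem_last mem') // ltn_add2l.
  + clearbody v; move=> {Q2 inv mem Pq Pt hQ m q' t'} i [m q' t'].
    move=> [[Q2 [inv /= mem hQ vE]] _ /= mv mi Pq Pt].
    rewrite mv mi (smem_last mem) // ltn_add2l => iN; rewrite /tick /=.
    set u := nth x (nbrs G v) i.
    run_step; run_step; rewrite mi (smem_adj mem) // -/u.
    run_step; apply: (@sort_ids_correct _ _ _ _ v u) => //; rewrite [_ + 6]/=.
    run_step; apply: halts_in_if.
    rewrite /tick [cells _]/= [holds _ _ _]/=.
    rewrite (_ : _ && _ = [&& u \in Q, u \notin Q2 & rank_lt G v u x y]);
      last first.
      rewrite /update /= (smem_lo mem) (smem_hi mem) !id_ltE -rank_lt_ends.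
      by rewrite (smem_depth mem) (smem_mark mem) eqb0 andbA.
    have uN : u \in nbrs G v by rewrite mem_nth.
    have [/and3P[uQ uQ2 lt_vu]|Nb] := boolP [&& _, _ & _]; last first.
      do !run_step; split=> //.
      - exists Q2; split=> //.
          apply: closure_inv_old => //; rewrite vE -/u => /and4P[_ _ uQ lt_vu].
          by move: Nb; rewrite uQ lt_vu andbT negbK.
        by case: mem => H1 H2 H3 H4 H5 H6 H7 H8 H9 H10 H11; split.
      - by rewrite /update /= mi addn1 addnS.
      - rewrite /=; lia.
    do !run_step; split=> //.
    - exists (rcons Q2 u); split=> //.
      + have := @closure_inv_new _ _ _ G x search_rel Q2 h i.
        rewrite vE -/u; apply=> //.
        by rewrite /search_rel /= uN vQ uQ.
      + case: mem => H1 H2 H3 H4 H5 H6 H7 H8 H9 H10 H11; split=> //.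
        * move=> w; rewrite /update /= val_eqE mem_rcons inE.
          by case: eqP.
        * move=> a; rewrite size_rcons /update /= H11 nth_rcons => aQ.
          case: eqP => [->|]; first by rewrite ltnn.
          by move=> aN; rewrite ifT ?H9 //; lia.
        * by rewrite /update /= H11 size_rcons addn1.
      + by rewrite size_rcons ltnW.
      + by rewrite nth_rcons hQ.
    - by rewrite /update /= mi addn1 addnS.
    - rewrite /=; lia.
  + clearbody v; move=> {Q2 inv mem Pq Pt hQ m q' t'} i [m q' t'].
    move=> [[Q2 [inv /= mem hQ vE]] iN /= mv mi Pq Pt].
    rewrite mv mi (smem_last mem) // ltn_add2l -leqNgt => iN'.
    have {iN iN'} iE : i = size (nbrs G v) by lia.
    rewrite /tick /=; do !run_step; split=> //.
    - exists Q2; split=> //.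
        by apply: closure_inv_next; rewrite ?vE -?iE.
      case: mem => H1 H2 H3 H4 H5 H6 H7 H8 H9 H10 H11; split=> //.
      by rewrite /update /= H10 addn1.
    - rewrite /=; have := dG v; lia.
  + split=> //.
    - exists Q2; split=> //.
      by case: mem => H1 H2 H3 H4 H5 H6 H7 H8 H9 H10 H11; split.
    - by rewrite /update /= addn0.
    - rewrite /=; lia.
- move=> h {m mx my mmark mdepth mlast madj} [m q' t'].
  move=> [[Q2 [inv /= mem hQ]] /= Pq Pt].
  rewrite (smem_head mem) (smem_tail mem) => hQ'.
  have hE : h = size Q2 by lia.
  rewrite {h}hE in inv mem Pt {hQ hQ'}.
  run_step; split=> //=.
  + move=> v; rewrite (smem_mark mem).
    by rewrite (closure_inv_done _ _ inv) // => a b /and4P[].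
  + exact: smem_y mem.
  + have : size Q2 <= size Q.
      apply: uniq_leq_size (closure_uniq inv) _ => v /(closure_connect inv).
      exact: connect_search_rel.
    nia.
- split=> //=; last lia.
  exists [:: x]; split=> //; first exact: closure_inv_init.
  split=> //.
  + by move=> v; rewrite /update /= mmark val_eqE inE; case: eqP.
  + by case.
Qed.

End CycleSearch.

(** * The Kruskal-based algorithm *)

Section Kruskal.
Variables (disp : Order.disp_t) (O : orderType disp) (n : nat) (G : graph O n).
Variables (R : realType) (k : R) (k_ge0 : (0 <= k)%R).

Lemma connect_search_rel_largest (x y : 'I_n) (Q : seq 'I_n) :
  y \in nbrs G x -> (forall v, (v \in Q) = (v \in ball_le G k x)) ->
  connect (search_rel G x y Q) x y =
  `[< largest_on_cycle G (ball_edges G k x) x y >].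
Proof.
move=> xy QE.
have relE : search_rel G x y Q =2 below G (ball_edges G k x) x y.
  move=> u v; rewrite -[RHS]/(adj _ u v && rank_lt G u v x y) adj_ball_edges.
  by rewrite /search_rel /= !QE !andbA.
have xQ : x \in Q by rewrite QE; apply/(ball_leP _ k_ge0); exists [::].
apply/idP/asboolP => [con|/largest_on_cycle_below].
  apply: below_largest_on_cycle; first exact: edges_neq xy.
    (* [y] lies in the ball because the search has reached it. *)
    rewrite -/(adj _ _ _) adj_ball_edges xy -!QE xQ.
    exact: connect_search_rel con.
  by rewrite -(eq_connect relE).
by rewrite (eq_connect relE).
Qed.

(** With [K] the integer part of [k], each of the two searches takes at most [400 * d ^ K.+1] steps
    up to a constant; the constants fit into the remaining [400 * d ^ K.+1]. *)
Lemma kruskal_runs (d : nat) (tape : nat -> nat) (x y : 'I_n) :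
  degree_bounded d G -> y \in nbrs G x ->
  exists q t, [/\ runs kruskal [:: Num.truncn k] tape G x y
      (~~ `[< largest_on_cycle G (ball_edges G k x) x y >]) q t,
    q <= 1200 * d ^ (Num.truncn k).+1 & t <= 1200 * d ^ (Num.truncn k).+1].
Proof.
move=> dG xy; set K := Num.truncn k.
have nbE := graph_oracle_neighbor G x; have idE := graph_oracle_id_lt G.
suff [f [s [E [ans Hq Ht]]]] :
    halts_in (graph_oracle G) kruskal
      (State (initial_memory n [:: K] tape x y) 0 0)
      (fun s => [/\ (0 < cells s ANSWER 0) =
           ~~ `[< largest_on_cycle G (ball_edges G k x) x y >],
         queries s <= 1200 * d ^ K.+1 & steps s <= 1200 * d ^ K.+1]).
  by exists (queries s), (steps s); split=> //; exists f, s.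
rewrite /kruskal; run_step; run_step.
apply: (halts_in_weaken (bfs_correct y K nbE tape dG)).
move=> [m q t] [Q [D [inv /= mem qle tle]]].
have QE v : (v \in Q) = (v \in ball_le G k x).
  have [toP ofP] := bfs_inv_done v inv.
  by apply/idP/(ball_leP _ k_ge0).
have xQ : x \in Q by rewrite -(bfs_depth_gt0 inv) (bfs_root inv).
have sQ : size Q <= 2 * d ^ K.
  apply: leq_trans (card_nball dG K xy).
  rewrite -(card_uniqP (bfs_uniq inv)); apply: subset_leq_card.
  apply/fintype.subsetP => v; rewrite QE => /(ball_leP _ k_ge0)[p [Pp <- sp]].
  exact: mem_nball.
have d0 : 0 < d by apply: leq_trans (dG x); case: (nbrs G x) xy.
have dK : 0 < d ^ K by rewrite expn_gt0 d0.
(* Here [d.+1 <= 2 * d] is combined with [size Q <= 2 * d ^ K]. *)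
have cost : size Q * d.+1 <= 4 * d ^ K.+1 by rewrite expnS; nia.
have cost1 : 0 < d ^ K.+1 by rewrite expn_gt0 d0.
have idxQ v : v \in Q -> index v Q < size Q by rewrite index_mem.
run_step; apply: halts_in_weaken.
  apply: (cycle_search_correct (x := x) (y := y) (Q := Q) (d := d) idE) => //.
  - exact: bmem_x mem.
  - exact: bmem_y mem.
  - exact: bmem_mark mem.
  - by move=> v; rewrite (bmem_depth mem) (bfs_depth_gt0 inv).
  - move=> v vQ; have := bmem_last mem (idxQ _ vQ) (idxQ _ vQ).
    by rewrite nth_index.
  - move=> v j vQ jN.
    have hd : handled (size Q) 0 (index v Q) j by rewrite /handled idxQ.
    have := bmem_adj mem hd (idxQ _ vQ).
    by rewrite nth_index // => /(_ jN)[].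
move=> [m' q' t'] /= [mark my Pq Pt].
run_step; apply: halts_in_if.
rewrite /tick [cells _]/= [holds _ _ _]/= my mark.
rewrite connect_search_rel_largest //.
by case: asboolP => _ /=; do !run_step; split=> //=; lia.
Qed.

Lemma kruskal_answers (tape : nat -> nat) (x y : 'I_n) :
  y \in nbrs G x ->
  answers kruskal [:: Num.truncn k] tape G x y
    (~~ `[< largest_on_cycle G (ball_edges G k x) x y >]).
Proof.
(* Neighbour lists have no repetitions, so [n] serves as a degree bound. *)
have nG : degree_bounded n G.
  move=> v; rewrite -(card_uniqP (nbrs_uniq G v)).
  by rewrite (leq_trans (max_card _)) ?card_ord.
by move=> /(kruskal_runs tape nG)[q [t [H _ _]]]; exists q, t.
Qed.

Lemma kept_edges_sub (tape : nat -> nat) (o : rel 'I_n) :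
  kept_edges kruskal [:: Num.truncn k] tape G o \subset edges G.
Proof.
apply/fintype.subsetP => e; rewrite inE => /asboolP[x [y [-> xy _ _]]].
by rewrite -/(adj _ _ _) adj_edges.
Qed.

Lemma kruskal_connected (tape : nat -> nat) (o : rel 'I_n) :
  connected_graph (edges G) -> orientation G o ->
  connected_graph (kept_edges kruskal [:: Num.truncn k] tape G o).
Proof.
move=> conG oG; apply: connected_of_smaller_paths conG _ => x y xy notin.
(* Each edge is queried only in the direction given by [o]; ranks are symmetric, so this may be
   taken to be from [x] to [y]. *)
wlog oxy : x y xy notin / o x y.
  move=> H; have [|Noxy] := boolP (o x y); first exact: H.
  have yx : x \in nbrs G y by rewrite nbrs_sym.
  have := H y x yx; rewrite finset.setUC oG // Noxy => /(_ notin isT) con.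
  rewrite sym_connect_sym; last exact: below_sym.
  rewrite (@eq_connect _ _ (below G (edges G) y x)) // => u v.
  by rewrite /below /= !rank_ltE (rankC G x).
have := kruskal_answers tape xy; case: asboolP => /= [lar _|_ ans].
  apply: connect_sub (largest_on_cycle_below lar) => u v uv.
  by apply: connect1; apply: below_ball uv.
by case/negP: notin; rewrite inE; apply/asboolP; exists x, y.
Qed.

Lemma kruskal_sparse (eps : R) (tape : nat -> nat) (o : rel 'I_n) :
  hyperfinite eps k G ->
  sparse eps (kept_edges kruskal [:: Num.truncn k] tape G o).
Proof.
move=> hyp; apply: (sparse_of_not_largest hyp); first exact: kept_edges_sub.
move=> e; rewrite inE => /asboolP[x [y [-> xy _ ans]]]; exists x, y; split=> //.
(* The program is deterministic, so an edge answered YES cannot also be answered NO. *)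
by have := answers_inj ans (kruskal_answers tape xy); case: asboolP.
Qed.

End Kruskal.

Local Open Scope ring_scope.

Theorem theorem4 (R : realType) :
  exists A : R, forall (disp : Order.disp_t) (O : orderType disp)
    (rho : R -> R) (eps : R) (d : nat),
    (forall x : R, 0 < x -> 0 <= rho x) ->
    0 < eps <= 1 ->
    let k := rho eps in
    let params := [:: Num.truncn k] in
    let family := @hyperfinite_family R disp O rho d in
    [/\ forall (n : nat) (G : graph O n) (tape : nat -> nat) (x y : 'I_n),
          y \in nbrs G x ->
          (largest_on_cycle G (ball_edges G k x) x y ->
             answers kruskal params tape G x y false) /\
          (~ largest_on_cycle G (ball_edges G k x) x y ->
             answers kruskal params tape G x y true),
        forall (dO : measure_display) (Omega : measurableType dO)
          (P : probability Omega R) (tape : Omega -> nat -> nat),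
          local_sparse_spanning family eps 0 kruskal params P tape,
        always_sparse family eps kruskal params &
        queries_and_time_le family kruskal params (A * d%:R `^ (k + 1))].
Proof.
exists 1200 => disp O rho eps d rho_ge0 eps01 k params family.
have k_ge0 : 0 <= k by apply: rho_ge0; case/andP: eps01.
split.
- move=> n G tape x y xy; have := kruskal_answers k_ge0 tape xy.
  by case: asboolP.
- move=> dO Omega P tape n G o conG [hyp dG] oG E' conn small.
  split.
  + by move=> w x y xy; eexists; exact: (kruskal_answers k_ge0 (tape w) xy).
  (* Connectivity holds for every sequence of random words, so the event is the whole space. *)
  + have -> : conn = setT.
      by apply/seteqP; split=> // w _; apply: kruskal_connected.
    by split; [exact: measurableT|exact: probability_setT].
  + have -> : small = setT.
      apply/seteqP; split=> // w _; apply: kruskal_sparse => //.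
      exact: hyp.
    by split; [exact: measurableT|rewrite probability_setT subr0].
- move=> n G o tape conG [hyp dG] oG; apply: kruskal_sparse => //.
  exact: hyp.
- move=> n G tape x y conG [hyp dG] xy.
  have [q [t [run qle tle]]] := kruskal_runs k_ge0 tape dG xy.
  have d1 : (1 <= d)%N by apply: leq_trans (dG x); case: (nbrs G x) xy.
  (* The integer part of [k] is at most [k], and powers grow with the exponent since the base [d] is
     at least 1. *)
  have le_pow : (d ^ (Num.truncn k).+1)%:R <= d%:R `^ (k + 1) :> R.
    rewrite natrX -powR_mulrn ?ler0n // ler_powR ?ler1n //.
    by rewrite -natr1 lerD2r truncn_le.
  have bound m : (m <= 1200 * d ^ (Num.truncn k).+1)%N ->
      m%:R <= 1200 * d%:R `^ (k + 1) :> R.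
    move=> mle; apply: le_trans (_ : (1200 * d ^ (Num.truncn k).+1)%:R <= _).
      by rewrite ler_nat.
    by rewrite natrM ler_wpM2l ?ler0n.
  exists (~~ `[< largest_on_cycle G (ball_edges G k x) x y >]), q, t.
  by split=> //; apply: bound.
Qed.
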